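(* Let $m,n\geq 3$ be integers and $D=\overrightarrow{C}_m[\overrightarrow{C}_n]$. For any complete coloring of $D$ with $k$ colors, \[k\leq \max\{\min\{f_n(x),g_n(x)\}: x\in\mathbb{N},\ x\geq 1\},\] where $f_n(x)=\lfloor mn/x\rfloor$ and $g_n(x)=x(n+1)+1$.
   Context: $\overrightarrow{C}_m$ is the directed cycle with vertex set $\mathbb{Z}_m$ and arcs $j\to j+1$. The lexicographic product $D[H]$ has vertex set $V(D)\times V(H)$, with an arc from $(u,a)$ to $(v,b)$ iff $uv\in A(D)$, or $u=v$ and $ab\in A(H)$. A coloring with $k$ colors is a surjection $V(D)\to[k]$ that is proper (each color class spans no arc); it is complete if for every ordered pair $(i,j)$ of distinct colors there is at least one arc from a vertex colored $i$ to a vertex colored $j$. *)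

(* Defs.v *)
From mathcomp Require Import all_boot all_order all_algebra.

Set Implicit Arguments.
Unset Strict Implicit.
Unset Printing Implicit Defensive.

(* A finite digraph is a finType of vertices with its arc relation: [d u v]
   means that there is an arc from u to v. *)

(* 'Z_m is the ring of integers modulo m only for 1 < m. *)
Definition dicycle (m : nat) : rel 'Z_m := fun i j => j == (i + 1)%R.

Definition lexprod (U V : finType) (d : rel U) (h : rel V) : rel (U * V) :=
  fun p q => d p.1 q.1 || (p.1 == q.1) && h p.2 q.2.

Section Colorings.
Variables (V : finType) (d : rel V) (k : nat).
Implicit Type c : V -> 'I_k.

Definition color_class c (i : 'I_k) : {set V} := [set v | c v == i].

Definition proper_coloring c : Prop :=
  (forall i, exists v, c v = i) /\
  (forall i u v, u \in color_class c i -> v \in color_class c i -> ~~ d u v).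

Definition complete_coloring c : Prop :=
  proper_coloring c /\
  (forall i j : 'I_k, i != j ->
     exists u v, [/\ u \in color_class c i, v \in color_class c j & d u v]).

End Colorings.

Definition f (m n x : nat) : nat := m * n %/ x.
Definition g (n x : nat) : nat := x * (n + 1) + 1.

Definition is_maximum (S : nat -> Prop) (M : nat) : Prop :=
  S M /\ (forall y, S y -> y <= M).

(* Main.v *)
Require Import Defs.
From mathcomp Require Import all_boot all_order all_algebra.

Set Implicit Arguments.
Unset Strict Implicit.
Unset Printing Implicit Defensive.

(** Take a smallest color class, of size [x].  Every class has at least [x]
    vertices, so [k * x <= m * n]; and each of the other [k - 1] colors receives
    an arc from this class, which has at most [x * (n + 1)] out-neighbors. *)

Lemma leq_card_bigcup (I T : finType) (A : {set I}) (F : I -> {set T}) (b : nat) :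
  (forall i, i \in A -> #|F i| <= b) -> #|\bigcup_(i in A) F i| <= #|A| * b.
Proof.
move=> leFb; rewrite -sum_nat_const.
apply: (big_ind2 (fun (B : {set T}) s => #|B| <= s)) => [|B1 s1 B2 s2 h1 h2|//].
  by rewrite cards0.
by apply: leq_trans (leq_add h1 h2); rewrite cardsU leq_subr.
Qed.

Section CompleteColorings.
Variables (V : finType) (d : rel V) (k : nat) (c : V -> 'I_k).

Lemma sum_card_color_class : \sum_(i < k) #|color_class c i| = #|V|.
Proof.
rewrite -sum1_card (partition_big c predT) //=; apply: eq_bigr => i _.
by rewrite -sum1_card; apply: eq_bigl => v; rewrite inE.
Qed.

Hypothesis hc : complete_coloring d c.

(** Surjectivity is what makes a class size an admissible [x >= 1] and allows division by it. *)
Lemma card_color_class_gt0 i : 0 < #|color_class c i|.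
Proof.
have [[/(_ i) [v cv] _] _] := hc.
by apply/card_gt0P; exists v; rewrite inE cv.
Qed.

Lemma complete_coloring_leq_outdegree b i :
  (forall u, #|[set v | d u v]| <= b) -> k <= #|color_class c i| * b + 1.
Proof.
move=> outb; have [_ complc] := hc.
set N := \bigcup_(u in color_class c i) [set v | d u v].
(* By completeness each color other than [i] occurs in the out-neighborhood [N], so
   [k.-1 <= #|c @: N| <= #|N|]. *)
have sub : [set~ i] \subset c @: N.
  apply/subsetP => j; rewrite !inE eq_sym => /complc [u [v [ui vj duv]]].
  apply/imsetP; exists v; last by move: vj; rewrite inE => /eqP.
  by apply/bigcupP; exists u => //; rewrite inE.
have: k.-1 <= #|color_class c i| * b.
  rewrite -[k in k.-1]card_ord -(cardsC1 i).
  apply: leq_trans (subset_leq_card sub) _.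
  by apply: leq_trans (leq_imset_card _ _) (leq_card_bigcup _).
by rewrite addn1 -ltnS; apply: leq_trans (leqSpred k).
Qed.

Lemma complete_coloring_leq_minn b :
  0 < k -> (forall u, #|[set v | d u v]| <= b) ->
  exists2 x, 0 < x & k <= minn (#|V| %/ x) (x * b + 1).
Proof.
move=> k_gt0 outb; pose i0 := Ordinal k_gt0.
pose i := [arg min_(i < i0) #|color_class c i|].
have mini j : #|color_class c i| <= #|color_class c j|.
  by rewrite /i; case: arg_minnP => // i' _; apply.
exists #|color_class c i|; first exact: card_color_class_gt0.
rewrite leq_min complete_coloring_leq_outdegree // andbT.
(* The floor bound becomes [k * x <= #|V|]: the [k] classes partition [V], each of size at least the
   minimum [x]. *)
rewrite leq_divRL ?card_color_class_gt0 // -sum_card_color_class.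
by rewrite -[k in k * _]card_ord -sum_nat_const; apply: leq_sum.
Qed.

End CompleteColorings.

(** The out-neighbors of [p] are full copies of [V] over the out-neighbors of [p.1], together with
    those of [p.2] inside the copy over [p.1]. A loop at [p.1] could make the two parts overlap,
    hence only an inequality. *)
Lemma card_lexprod_out (U V : finType) (d : rel U) (h : rel V) (p : U * V) :
  #|[set q | lexprod d h p q]| <=
  #|[set u | d p.1 u]| * #|V| + #|[set v | h p.2 v]|.
Proof.
rewrite -(cardsT V) -cardsX -[X in _ + X]mul1n -(cards1 p.1) -cardsX.
apply: leq_trans (leq_card_setU _ _).
apply: subset_leq_card; apply/subsetP => q.
by rewrite !inE /lexprod andbT eq_sym.
Qed.

Lemma card_dicycle_out (m : nat) (i : 'Z_m) : #|[set j | dicycle i j]| = 1.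
Proof.
rewrite (_ : [set j | _] = [set (i + 1)%R]) ?cards1 //.
by apply/setP => j; rewrite !inE.
Qed.

Lemma f_eq0 m n x : m * n < x -> f m n x = 0.
Proof. by move=> ltx; rewrite /f divn_small. Qed.

(** Since [f] vanishes for [x > m * n], only [x] from 1 to [m * n] matter; [F] indexes them shifted
    by one. *)
Lemma minn_f_g_maximum (m n : nat) : 0 < m * n ->
  exists M, is_maximum
    (fun y => exists x : nat, 1 <= x /\ y = minn (f m n x) (g n x)) M.
Proof.
move=> mn_gt0; pose F (x : 'I_(m * n)) := minn (f m n x.+1) (g n x.+1).
(* The maximum is attained because [0 < m * n] makes the index type nonempty. *)
have [|x0 Mx0] := @eq_bigmax _ F; first by rewrite card_ord.
exists (\max_x F x); split=> [|y [x [x_gt0 ->]]]; first by exists x0.+1.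
have [ltx|lex] := ltnP (m * n) x; first by rewrite f_eq0 ?min0n.
have ltx : x.-1 < m * n by rewrite prednK.
by have := leq_bigmax (F := F) (Ordinal ltx); rewrite /F /= prednK.
Qed.

Theorem theorem7 (m n : nat) (hm : 3 <= m) (hn : 3 <= n)
    (k : nat) (c : 'Z_m * 'Z_n -> 'I_k)
    (hc : complete_coloring (lexprod (@dicycle m) (@dicycle n)) c) :
  exists M : nat,
    is_maximum (fun y => exists x : nat, 1 <= x /\ y = minn (f m n x) (g n x)) M
    /\ k <= M.
Proof.
have cardZ p : 3 <= p -> #|'Z_p| = p.
  by move=> p_ge3; rewrite card_ord Zp_cast // ltnW.
have [|M maxM] := @minn_f_g_maximum m n.
  by rewrite muln_gt0 !(leq_trans _ hm, leq_trans _ hn).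
exists M; split=> //.
(* The color of any one vertex is an element of ['I_k]. *)
have k_gt0 : 0 < k by case: (c (0%R, 0%R)) => i /(leq_ltn_trans (leq0n _)).
(* A vertex sends arcs to all [n] vertices of the next copy and to one successor in its own. *)
have out p : #|[set q | lexprod (@dicycle m) (@dicycle n) p q]| <= n + 1.
  apply: leq_trans (card_lexprod_out _ _ _) _.
  by rewrite !card_dicycle_out mul1n cardZ.
have [x x_gt0 lek] := complete_coloring_leq_minn hc k_gt0 out.
apply: leq_trans lek (maxM.2 _ _); exists x.
by rewrite card_prod !cardZ.
Qed.
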